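(* Let $(X,d)$ be a complete metric space equipped with a doubling measure $\mu$, and let $E\subset X$ be a subset. Then the following statements are equivalent: (A) $E$ is weakly porous and $h_E$ satisfies the doubling condition. (B) There exists $\alpha>0$ for which the function $x\mapsto \operatorname{dist}(x,E)^{-\alpha}$ belongs to the Muckenhoupt class $A_1(X)$.
   Context: Setting: $(X,d)$ is a complete metric space, $B(x,r)=\{y\in X: d(x,y)<r\}$, and $\mu$ is a complete Borel regular measure on $X$ for which there is a constant $C_\mu>0$ with $0<\mu(B(x,2r))\le C_\mu\,\mu(B(x,r))<\infty$ for all $x\in X$, $r>0$. Balls are open and come with a prescribed center and radius. $\operatorname{dist}(x,E)=\inf\{d(x,y):y\in E\}$ (with $\inf\emptyset=+\infty$), and for $\alpha>0$, $\operatorname{dist}(x,E)^{-\alpha}=+\infty$ when $\operatorname{dist}(x,E)=0$. Maximal $E$-free hole: for a ball $B=B(x,R)$, $h_E(B)=\sup\{0<r\le 2R:\ \text{there exists } y\in X \text{ with } B(y,r)\subset B(x,R)\setminus E\}$, with $h_E(B)=0$ if there is no such $r$. Weak porosity: $E$ is weakly porous if there are constants $c,\delta\in(0,1)$ such that for every ball $B=B(x,R)\subset X$ there is a finite collection of mutually disjoint open balls $B_i=B(x_i,r_i)$, $i=1,\dots,N$, contained in $B\setminus E$, with $\delta h_E(B)\le r_i\le 2R$ for every $i$ and $\sum_{i=1}^N\mu(B_i)\ge c\,\mu(B)$. Doubling condition for $h_E$: there is $C>0$ with $h_E(B(x,2R))\le C\,h_E(B(x,R))$ for all $x\in X$, $R>0$.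 A weight is a nonnegative locally integrable function $w$ on $X$. A weight $w$ belongs to $A_1(X)$ if there is a constant $C\ge0$ with $\frac1{\mu(B)}\int_B w\,d\mu\le C\operatorname{ess\,inf}_{B}w$ for every ball $B\subset X$. *)

(* Defs.v *)
From HB Require Import structures.
From mathcomp Require Import all_boot all_order all_algebra.
From mathcomp Require Import all_classical all_reals all_analysis.
From mathcomp Require Import measurable_realfun.

Set Implicit Arguments.
Unset Strict Implicit.
Unset Printing Implicit Defensive.

Import Order.TTheory GRing.Theory Num.Theory.
Import numFieldNormedType.Exports.

Local Open Scope classical_set_scope.
Local Open Scope ring_scope.

(* The two structures are independent here: compatibility of the sigma-algebra
   with the topology is part of [borel_regular]. *)
#[short(type="completeMetricMeasurableType")]
HB.structure Definition CompleteMetricMeasurable (d : measure_display)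
    (R : numDomainType) :=
  {T of Measurable d T & Complete T & Metric R T}.

Section definitions.
Context {d : measure_display} {R : realType}.
Context {X : completeMetricMeasurableType d R}.
Implicit Types (mu : {measure set X -> \bar R}) (E : set X).

Definition borel_regular mu : Prop :=
  (forall U : set X, open U -> measurable U) /\
  (forall A : set X, measurable A ->
     exists B : set X, [/\ <<s @open X >> B, A `<=` B & mu B = mu A]).

Definition doubling_measure mu : Prop :=
  exists2 C : R, 0 < C & forall (x : X) (r : R), 0 < r ->
    [/\ (0 < mu (ball x (2 * r)))%E,
        (mu (ball x (2 * r)) <= C%:E * mu (ball x r))%E
      & (C%:E * mu (ball x r) < +oo)%E].

(* The supremum of the empty set is 0 in the library (lemma [sup0]). *)
Definition max_hole E (x : X) (s : R) : R :=
  sup [set r : R | [/\ 0 < r, r <= 2 * s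
                     & exists y : X, ball y r `<=` ball x s `\` E]].

Definition weakly_porous mu E : Prop :=
  exists c delta : R, [/\ 0 < c < 1, 0 < delta < 1 &
    forall (x : X) (s : R), 0 < s ->
      exists (N : nat) (y : 'I_N -> X) (r : 'I_N -> R),
        [/\ forall i, 0 < r i,
            forall i j, i != j -> ball (y i) (r i) `&` ball (y j) (r j) = set0,
            forall i, ball (y i) (r i) `<=` ball x s `\` E,
            forall i, delta * max_hole E x s <= r i <= 2 * s
          & (c%:E * mu (ball x s) <= \sum_(i < N) mu (ball (y i) (r i)))%E]].

Definition max_hole_doubling E : Prop :=
  exists2 C : R, 0 < C & forall (x : X) (s : R), 0 < s ->
    max_hole E x (2 * s) <= C * max_hole E x s.

Definition set_dist (x : X) E : \bar R :=
  ereal_inf [set (mdist x y)%:E | y in E].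

(* Inverting in [\bar R] gives the intended values at the extremes, as
   [0^-1 = +oo] and [+oo^-1 = 0]; the library's [0 `^ (- a)] would be 0. *)
Definition dist_weight E (a : R) (x : X) : \bar R :=
  ((set_dist x E `^ a)^-1)%E.

Definition is_weight mu (w : X -> \bar R) : Prop :=
  [/\ measurable_fun [set: X] w,
      forall x, (0 <= w x)%E
    & forall x, exists2 r : R, 0 < r & mu.-integrable (ball x r) w].

(* [ess_inf] relative to a subset. *)
Definition ess_inf_on mu (D : set X) (w : X -> \bar R) : \bar R :=
  ereal_sup [set t | \forall x \ae mu, D x -> (t <= w x)%E].

Definition muckenhoupt_A1 mu (w : X -> \bar R) : Prop :=
  is_weight mu w /\
  exists2 C : R, 0 <= C & forall (z : X) (r : R), 0 < r ->
    ((mu (ball z r))^-1 * \int[mu]_(x in ball z r) w x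
       <= C%:E * ess_inf_on mu (ball z r) w)%E.

End definitions.

(* Main.v *)
(** From (B) to (A), write h for the hole radius of a ball B and w for the
    distance weight.  A largest hole of B contains a ball on which
    w <= (h/4)^-a, so A_1 gives a bound of order h^-a for the average of w over
    B.  By Chebyshev, points of B at distance less than eps h from E fill only a
    small fraction of B, and disjoint balls of radius eps h around the others
    witness weak porosity; if h is small compared with the radius of B, then
    w >= (2h)^-a on half of B, which compared with the bound on 2B gives
    doubling of h.

    From (A) to (B), fix B with hole radius h.  Around each point y choose a
    radius s with h(B(y, s)) comparable to t.  Such a ball lies in the
    (2 D t)-neighborhood of E, while porosity puts a fixed fraction of it at
    distance at least a multiple of t from E.  A Vitali covering then shows that
    the measure of the neighborhoods of E of radii h q^k, in balls that shrink to
    B, decays like theta^k: doubling of h makes s decay geometrically in k, so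
    that the total enlargement of B is bounded.  Summing over the layers, w has
    average at most a multiple of h^-a on B once q^-a theta < 1; the essential
    infimum of w on B is at least a multiple of h^-a if B is close to E, and w is
    nearly constant on B otherwise. *)

Require Import Defs.
From mathcomp Require Import all_boot all_order all_algebra.
From mathcomp Require Import all_classical all_reals all_analysis.
From mathcomp Require Import measurable_realfun.
From mathcomp Require Import ring lra.

Set Implicit Arguments.
Unset Strict Implicit.
Unset Printing Implicit Defensive.

Import Order.TTheory GRing.Theory Num.Theory.
Import numFieldNormedType.Exports.

Local Open Scope classical_set_scope.
Local Open Scope ring_scope.

(** * Balls, open neighborhoods of a set, and a finite Vitali covering *)

Section metric_space.
Context {R : realType} {X : metricType R}.
Implicit Types (x y z : X) (r s t : R) (A E : set X).

Lemma in_ballE x r y : ball x r y = (mdist x y < r) :> Prop.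
Proof. by rewrite ballEmdist. Qed.

Lemma subset_ball x y r s : mdist y x + r <= s -> ball x r `<=` ball y s.
Proof.
move=> rs z; rewrite !in_ballE => xz.
by apply: le_lt_trans (metric_triangle y x z) _; lra.
Qed.

Lemma metric_ball_open x r : open (ball x r).
Proof.
rewrite openE => y /=; rewrite in_ballE => xy.
have e0 : 0 < r - mdist x y by rewrite subr_gt0.
apply/nbhs_ballP; exists (r - mdist x y) => //=.
by apply: subset_ball; lra.
Qed.

(** The sublevel set dist(., E) < t without the infimum: a union of open balls, hence Borel for
    arbitrary [E], and empty when [E] is. *)
Definition neighborhood E t : set X := [set x | exists2 e, E e & mdist x e < t].

Lemma neighborhood_open E t : open (neighborhood E t).
Proof.
rewrite (_ : neighborhood E t = \bigcup_(e in E) ball e t).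
  by apply: bigcup_open => e _; exact: metric_ball_open.
by apply/seteqP; split => [z [e Ee ez]|z [e Ee]]; [exists e => //|
  move=> ez; exists e => //]; move: ez; rewrite in_ballE metric_sym.
Qed.

Lemma le_neighborhood E s t : s <= t -> neighborhood E s `<=` neighborhood E t.
Proof. by move=> st z [e Ee ez]; exists e => //; exact: lt_le_trans st. Qed.

Lemma neighborhood_near E x y s t : neighborhood E s x -> mdist y x + s <= t ->
  neighborhood E t y.
Proof.
move=> [e Ee xe] st; exists e => //.
by apply: le_lt_trans (metric_triangle y x e) _; lra.
Qed.

Lemma ball_disjoint_neighborhood E x r t :
  ball x r `<=` ~` E -> ball x (r - t) `<=` ~` neighborhood E t.
Proof.
move=> xE z; rewrite in_ballE => xz [e Ee ze]; apply: (xE e) => //.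
by rewrite in_ballE; apply: le_lt_trans (metric_triangle x z e) _; lra.
Qed.

Definition disjoint_balls (s : X -> R) : rel X :=
  fun y z => `[< ball y (s y) `&` ball z (s z) = set0 >].

(* Finite form of Vitali's covering lemma: greedily select a ball whose radius
   is at least half of the largest available one. *)
Lemma finite_vitali (s : X -> R) (M : R) (N : nat) A :
  (forall y, A y -> 0 < s y <= M) ->
  (forall l : seq X, (forall y, y \in l -> A y) ->
    pairwise (disjoint_balls s) l -> (size l <= N)%N) ->
  exists l : seq X, [/\ forall y, y \in l -> A y, pairwise (disjoint_balls s) l
    & A `<=` [set z | exists2 y, y \in l & ball y (4 * s y) z]].
Proof.
elim: N A => [|N IH] A sM cardA.
  have [->|/set0P[y Ay]] := eqVneq A set0; first by exists [::]; split=> // ? .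
  suff: (size [:: y] <= 0)%N by [].
  by apply: cardA => // z; rewrite inE => /eqP ->.
have [->|/set0P[y0 Ay0]] := eqVneq A set0; first by exists [::]; split=> // ? .
pose S := s @` A.
have Sub : has_ubound S by exists M => _ [y Ay <-]; case/andP: (sM _ Ay).
have sS y : A y -> s y <= sup S by move=> Ay; apply: ub_le_sup => //; exists y.
have supS0 : 0 < sup S.
  by apply: lt_le_trans (sS _ Ay0); case/andP: (sM _ Ay0).
have [_ [y Ay <-] ySsup] : exists2 r, S r & sup S / 2 < r.
  by apply: sup_gt; [exists (s y0), y0|lra].
(* Any disjoint family centered in [A'] can be extended by [y], so [A'] inherits the packing bound
   [N]. *)
pose A' := A `&` [set z | disjoint_balls s y z].
have [||l [lA' ldisj lcov]] := IH A'.
- by move=> z [Az _]; exact: sM.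
- move=> l lA' ldisj; rewrite -ltnS; apply: (cardA (y :: l)) => /=.
    by move=> z; rewrite inE => /predU1P[->//|/lA'[]].
  by rewrite ldisj andbT; apply/allP => z /lA'[].
exists (y :: l); split => /=.
- by move=> z; rewrite inE => /predU1P[->//|/lA'[]].
- by rewrite ldisj andbT; apply/allP => z /lA'[].
move=> z Az; have [yz|yz] := boolP (disjoint_balls s y z).
  by have [u ul uz] := lcov z (conj Az yz); exists u; rewrite // inE ul orbT.
exists y; first by rewrite inE eqxx.
(* The balls at [y] and [z] meet and [s z < 2 * s y], so the center [z] lies within [3 * s y] of
   [y]. *)
move: yz => /asboolPn/eqP/set0P[u []]; rewrite !in_ballE => yu zu.
have := metric_triangle y u z; rewrite (metric_sym u z).
by have := sS _ Az; lra.
Qed.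

End metric_space.

(** * Elementary bounds on the hole radius *)

Section holes.
Context {d : measure_display} {R : realType}.
Context {X : completeMetricMeasurableType d R}.
Implicit Types (x y z : X) (r s t : R) (E : set X).

Let holes E x s := [set r : R | [/\ 0 < r, r <= 2 * s
  & exists y : X, ball y r `<=` ball x s `\` E]].

Lemma max_hole_ge E x s r y : 0 < r -> r <= 2 * s ->
  ball y r `<=` ball x s `\` E -> r <= max_hole E x s.
Proof.
move=> r0 rs yr; apply: ub_le_sup; first by exists (2 * s) => ? [].
by split => //; exists y.
Qed.

Lemma max_hole_ge0 E x s : 0 <= max_hole E x s.
Proof.
have [h0|/set0P[r [r0 rs [y yr]]]] := eqVneq (holes E x s) set0.
  by rewrite /max_hole -/(holes E x s) h0 sup0.
exact: le_trans (ltW r0) (max_hole_ge r0 rs yr).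
Qed.

Lemma max_hole_le E x s t : 0 <= t ->
  (forall r y, 0 < r -> r <= 2 * s -> ball y r `<=` ball x s `\` E -> r <= t) ->
  max_hole E x s <= t.
Proof.
move=> t0 H; have [h0|/set0P hn0] := eqVneq (holes E x s) set0.
  by rewrite /max_hole -/(holes E x s) h0 sup0.
by apply: ge_sup => // r [r0 rs [y yr]]; exact: H yr.
Qed.

Lemma max_hole_le2 E x s : 0 <= s -> max_hole E x s <= 2 * s.
Proof. by move=> s0; apply: max_hole_le => //; rewrite mulr_ge0. Qed.

Lemma max_hole_gt E x s t : 0 <= t -> t < max_hole E x s ->
  exists r y, [/\ t < r, r <= 2 * s & ball y r `<=` ball x s `\` E].
Proof.
move=> t0 th; have [|r [r0 rs [y yr]] tr] := sup_gt _ th.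
  by apply/set0P/eqP => h0; move: th; rewrite /max_hole h0 sup0 ltNge t0.
by exists r, y.
Qed.

Lemma le_max_hole E x y s t : s <= t -> ball x s `<=` ball y t ->
  max_hole E x s <= max_hole E y t.
Proof.
move=> st sub; apply: max_hole_le (max_hole_ge0 _ _ _) _ => r z r0 rs zr.
by apply: (@max_hole_ge _ _ _ _ z) => // [|u /zr[/sub]//]; lra.
Qed.

(** Mostly used contrapositively: once [t] exceeds the hole radius, every center of a [t]-ball
    fitting into the ball is within [t] of [E]. *)
Lemma far_le_max_hole E x y s t : 0 < t -> mdist x y + t <= s ->
  ~ neighborhood E t y -> t <= max_hole E x s.
Proof.
move=> t0 ts yE; apply: (@max_hole_ge _ _ _ _ y) => //.
  by have := mdist_ge0 x y; lra.
move=> z yz; split; first exact: subset_ball yz.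
by move=> Ez; apply: yE; exists z => //; move: yz; rewrite in_ballE.
Qed.

End holes.

(** * Measures of finite disjoint families and finite covers *)

Section finite_measure_sums.
Context {d : measure_display} {R : realType} {T : measurableType d}.
Variable mu : {measure set T -> \bar R}.
Local Open Scope ereal_scope.

Lemma sum_measure_le (I : eqType) (l : seq I) (F : I -> set T) (U : set T) :
  measurable U -> (forall i, i \in l -> measurable (F i)) ->
  (forall i, i \in l -> F i `<=` U) ->
  pairwise (fun i j => `[< F i `&` F j = set0 >]) l ->
  \sum_(i <- l) mu (F i) <= mu U.
Proof.
elim: l U => [|i l IH] U mU mF FU; first by rewrite big_nil.
rewrite /= => /andP[/allP disj ldisj]; rewrite big_cons.
have mi : measurable (F i) by apply: mF; rewrite inE eqxx.
rewrite (measureDI mu mU mi) addeC leeD//.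
  apply: IH => // [|j jl|j jl]; first exact: measurableD.
    by apply: mF; rewrite inE jl orbT.
  move=> z Fjz; split; first by apply: FU Fjz; rewrite inE jl orbT.
  by move=> Fiz; have /asboolP Fij := disj j jl; rewrite -[False]/(set0 z) -Fij.
by rewrite setIC (setIidl (FU i _)) ?inE ?eqxx.
Qed.

Lemma measure_le_sum (I : eqType) (l : seq I) (F : I -> set T) (A : set T) :
  measurable A -> (forall i, i \in l -> measurable (F i)) ->
  A `<=` [set z | exists2 i, i \in l & F i z] ->
  mu A <= \sum_(i <- l) mu (F i).
Proof.
elim: l A => [|i l IH] A mA mF AF.
  rewrite big_nil (_ : A = set0) ?measure0// -subset0 => z /AF[i].
  by rewrite in_nil.
have mi : measurable (F i) by apply: mF; rewrite inE eqxx.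
rewrite big_cons (measureDI mu mA mi) addeC leeD//.
  by apply: le_measure; rewrite ?inE//; exact: measurableI.
apply: IH => [|j jl|z [/AF[j]]]; first exact: measurableD.
  by apply: mF; rewrite inE jl orbT.
by rewrite inE => /predU1P[->//|jl Fz _]; exists j.
Qed.

End finite_measure_sums.

(** * Doubling measures: packing and covering *)

Section doubling.
Context {d : measure_display} {R : realType}.
Context {X : completeMetricMeasurableType d R}.
Implicit Types (x y z : X) (r s t : R) (E : set X).

Definition doubling_with (mu : {measure set X -> \bar R}) (C : R) : Prop :=
  [/\ 1 <= C, forall U : set X, open U -> measurable U
    & forall x r, 0 < r -> [/\ (0 < mu (ball x r))%E, (mu (ball x r) < +oo)%E
        & (mu (ball x (2 * r)) <= C%:E * mu (ball x r))%E]].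

Lemma doubling_measureP (mu : {measure set X -> \bar R}) :
  borel_regular mu -> doubling_measure mu -> exists C, doubling_with mu C.
Proof.
move=> [mo _] [C C0 dbl]; exists (Num.max 1 C).
split=> [|//|x r r0]; first by rewrite le_max lexx.
(* Positivity is given for balls of radius [2 * r], so it is read off at [r / 2]. *)
have [r2 _ _] := dbl x (r / 2) (divr_gt0 r0 (ltr0Sn _ 1)).
have [_ Cr rC] := dbl x r r0.
split; first by move: r2; rewrite mulrC divfK.
  by rewrite ltey; apply/eqP => re; move: rC; rewrite re gt0_muley ?lte_fin// ltxx.
apply: le_trans Cr _; apply: lee_wpmul2r => //.
by rewrite lee_fin le_max lexx orbT.
Qed.

Context {mu : {measure set X -> \bar R}} {C : R} (muC : doubling_with mu C).

Let C1 : 1 <= C. Proof. by case: muC. Qed.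
Let C0 : 0 < C. Proof. exact: lt_le_trans C1. Qed.

Lemma measurable_ball_doubling x r : measurable (ball x r).
Proof. by case: muC => _ + _; apply; exact: metric_ball_open. Qed.

Lemma measurable_neighborhood E t : measurable (neighborhood E t).
Proof. by case: muC => _ + _; apply; exact: neighborhood_open. Qed.

Hint Resolve measurable_ball_doubling measurable_neighborhood : core.

Lemma mu_ball_gt0 x r : 0 < r -> (0 < mu (ball x r))%E.
Proof. by case: muC => _ _ /(_ x r) H /H[]. Qed.

Lemma mu_ball_fin x r : mu (ball x r) \is a fin_num.
Proof.
have [r0|r0] := ltP 0 r.
  by rewrite ge0_fin_numE//; case: muC => _ _ /(_ x r r0) [].
rewrite (_ : ball x r = set0) ?measure0// -subset0 => z.
by rewrite in_ballE; have := mdist_ge0 x z; lra.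
Qed.

Lemma mu_ball_fin_sub x r (A : set X) : measurable A -> A `<=` ball x r ->
  mu A \is a fin_num.
Proof.
move=> mA Ax; rewrite ge0_fin_numE//.
apply: le_lt_trans (_ : mu (ball x r) < +oo)%E.
  by apply: le_measure; rewrite ?inE.
by rewrite ltey_eq mu_ball_fin.
Qed.

Lemma mu_ball_pow2 k x r : 0 < r ->
  (mu (ball x (2 ^+ k * r)) <= (C ^+ k)%:E * mu (ball x r))%E.
Proof.
move=> r0; elim: k => [|k IH]; first by rewrite !expr0 mul1r mul1e.
rewrite !exprS -mulrA EFinM -muleA.
have kr : 0 < 2 ^+ k * r by rewrite mulr_gt0// exprn_gt0.
case: muC => _ _ /(_ x _ kr)[_ _ H]; apply: le_trans H _.
by apply: lee_wpmul2l => //; rewrite lee_fin ltW.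
Qed.

(** Choose [k] with [2 * r <= 2 ^+ k * e]. Enlarged [2 ^+ k] times, each ball of the family covers
    [ball x r], so it carries at least the fraction [C ^- k] of its measure; disjointness then
    bounds their number. *)
Lemma size_disjoint_balls (s : X -> R) x r e : 0 < e -> exists N,
  forall l, (forall y, y \in l -> e <= s y /\ ball y (s y) `<=` ball x r) ->
    pairwise (disjoint_balls s) l -> (size l <= N)%N.
Proof.
move=> e0; have [k kre] : exists k, r + r <= 2 ^+ k * e.
  exists (Num.truncn ((r + r) / e)).+1; rewrite -ler_pdivrMr//.
  apply: le_trans (ltW (truncnS_gt _)) _.
  by rewrite -natrX ler_nat ltnW// ltn_expl.
exists (Num.truncn (C ^+ k)) => l ls ldisj.
rewrite truncn_ge_nat; last by rewrite exprn_ge0// ltW.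
(* A nonempty family forces [r > 0], so that the measure of [ball x r] can be cancelled. *)
have [->|r0] : l = [::] \/ 0 < r.
- case: l ls {ldisj} => [|y l ls]; [by left|right].
  have [es yx] := ls y (mem_head _ _).
  have : ball x r y by apply: yx; rewrite in_ballE mdistxx; lra.
  by rewrite in_ballE; have := mdist_ge0 x y; lra.
- by rewrite exprn_ge0// ltW.
have xr0 : 0 < fine (mu (ball x r)).
  by rewrite fine_gt0// mu_ball_gt0//= ltey_eq mu_ball_fin.
rewrite -(ler_pM2r xr0) -lee_fin !EFinM (fineK (mu_ball_fin _ _)).
have key y : y \in l ->
    (mu (ball x r) <= (C ^+ k)%:E * mu (ball y (s y)))%E.
  move=> yl; have [es yx] := ls y yl.
  have s0 : 0 < s y by lra.
  have xy : mdist x y < r by rewrite -in_ballE; apply: yx; rewrite in_ballE mdistxx.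
  apply: le_trans _ (mu_ball_pow2 k y s0).
  apply: le_measure; rewrite ?inE//; apply: subset_ball.
  rewrite metric_sym.
  have : 2 ^+ k * e <= 2 ^+ k * s y by rewrite ler_pM2l// exprn_gt0.
  lra.
apply: (@le_trans _ _ (\sum_(y <- l) mu (ball x r))%E).
  by rewrite big_const_seq count_predT iter_addr_0 mule_natl.
apply: le_trans.
  by rewrite big_seq; apply: lee_sum => y yl; exact: key yl.
rewrite -big_seq -ge0_sume_distrr//; apply: lee_wpmul2l.
  by rewrite lee_fin exprn_ge0// ltW.
apply: sum_measure_le => // y yl; by have [] := ls y yl.
Qed.

(** The lower bound [e] on the radii yields the packing bound required by [finite_vitali]; its
    enlargement factor 4 costs two doublings. *)
Lemma doubling_vitali (s : X -> R) (e M : R) x r (A : set X) :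
  measurable A -> 0 < e ->
  (forall y, A y -> [/\ e <= s y, s y <= M & ball y (s y) `<=` ball x r]) ->
  exists l : seq X, [/\ forall y, y \in l -> A y, pairwise (disjoint_balls s) l
    & (mu A <= (C ^+ 2)%:E * \sum_(y <- l) mu (ball y (s y)))%E].
Proof.
move=> mA e0 As; have [N cardN] := size_disjoint_balls s x r e0.
have s0 y : A y -> 0 < s y by move=> /As[]; lra.
have [||l [lA ldisj Al]] := @finite_vitali _ _ s M N A.
- by move=> y Ay; rewrite s0//; have [] := As y Ay.
- by move=> l lA; apply: cardN => y /lA/As[].
exists l; split => //.
apply: (@le_trans _ _ (\sum_(y <- l) mu (ball y (4 * s y)))%E).
  by apply: measure_le_sum => //.
rewrite ge0_sume_distrr// big_seq [leRHS]big_seq; apply: lee_sum => y /lA Ay.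
have := mu_ball_pow2 2 y (s0 y Ay).
by rewrite (_ : 2 ^+ 2 = 4)//; ring.
Qed.

End doubling.

(** * Pointwise bounds and measurability of the distance weight *)

Section dist_weight.
Context {d : measure_display} {R : realType}.
Context {X : completeMetricMeasurableType d R}.
Implicit Types (x y z : X) (r s t a : R) (E : set X).

Lemma set_dist_ltP E z t : (set_dist z E < t%:E)%E <-> neighborhood E t z.
Proof.
split=> [/ereal_inf_lt[_ [e Ee <-]]|[e Ee ze]].
  by rewrite lte_fin; exists e.
apply: le_lt_trans (_ : (mdist z e)%:E < _)%E => //.
by apply: ge_ereal_inf; exists (mdist z e)%:E => //; exists e.
Qed.

Lemma set_dist_ge0 E z : (0 <= set_dist z E)%E.
Proof.
by apply/ereal_infP => _ [e Ee <-]; rewrite lee_fin mdist_ge0.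
Qed.

Lemma set_dist_triangle E y z :
  (set_dist y E <= (mdist y z)%:E + set_dist z E)%E.
Proof.
rewrite -leeBlDl//; apply/ereal_infP => _ [e Ee <-].
rewrite leeBlDl// -EFinD; apply: le_trans (_ : (mdist y e)%:E <= _)%E.
  by apply: ge_ereal_inf; exists (mdist y e)%:E => //; exists e.
by rewrite lee_fin metric_triangle.
Qed.

Lemma dist_weight_ge0 E a z : (0 <= dist_weight E a z)%E.
Proof. by rewrite inve_ge0 poweR_ge0. Qed.

(** The extended [u] admits [u = 0], where the lower bound is infinite. *)
Lemma le_dist_weight E a z (u : \bar R) : 0 < a -> (0 <= u)%E ->
  (set_dist z E <= u)%E -> ((u `^ a)^-1 <= dist_weight E a z)%E.
Proof.
move=> a0 u0 zu; rewrite lee_pV2 ?inE ?poweR_ge0//.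
by apply: gt0_ler_poweR; rewrite ?(ltW a0)// in_itv/= ?u0 ?set_dist_ge0 leey.
Qed.

Lemma dist_weight_le E a z (u : \bar R) : 0 < a -> (0 <= u)%E ->
  (u <= set_dist z E)%E -> (dist_weight E a z <= (u `^ a)^-1)%E.
Proof.
move=> a0 u0 zu; rewrite lee_pV2 ?inE ?poweR_ge0//.
by apply: gt0_ler_poweR; rewrite ?(ltW a0)// in_itv/= ?u0 ?set_dist_ge0 leey.
Qed.

Lemma poweR_inv_powRN t a : 0 < t -> ((t%:E `^ a)^-1 = (t `^ (- a))%:E)%E.
Proof.
move=> t0; rewrite poweR_EFin inver powRN gt_eqF// powR_gt0//.
Qed.

Lemma dist_weight_near E a z t : 0 < a -> 0 < t -> neighborhood E t z ->
  ((t `^ (- a))%:E <= dist_weight E a z)%E.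
Proof.
move=> a0 t0 /set_dist_ltP/ltW zt; rewrite -poweR_inv_powRN//.
by apply: le_dist_weight => //; rewrite lee_fin ltW.
Qed.

Lemma dist_weight_far E a z t : 0 < a -> 0 < t -> ~ neighborhood E t z ->
  (dist_weight E a z <= (t `^ (- a))%:E)%E.
Proof.
move=> a0 t0 zt; rewrite -poweR_inv_powRN//.
apply: dist_weight_le => //; first by rewrite lee_fin ltW.
by rewrite leNgt; apply/negP => /set_dist_ltP.
Qed.

Lemma measurable_dist_weight E a : 0 < a ->
  (forall U : set X, open U -> measurable U) ->
  measurable_fun [set: X] (dist_weight E a).
Proof.
move=> a0 mo.
have md : measurable_fun [set: X] (set_dist ^~ E).
  apply: (measurability _ (ErealGenInftyO.measurableE R)) => _ [_ [t ->] <-].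
  rewrite setTI (_ : _ @^-1` _ = neighborhood E t).
    exact/mo/neighborhood_open.
  apply/seteqP; split => z /=; rewrite in_itv/=; first by move/set_dist_ltP.
  by move=> ?; exact/set_dist_ltP.
have mp : measurable_fun [set: X] (fun z => set_dist z E `^ a)%E.
  exact: (measurableT_comp (measurable_poweR _)).
apply: (measurability _ (ErealGenCInfty.measurableE R)) => _ [_ [t ->] <-].
(* The superlevel set at [t] is everything for [t <= 0]; otherwise inversion turns it into a
   sublevel set of the power of the distance. *)
have [t0|t0] := leP t 0.
  rewrite (_ : _ @^-1` _ = setT) ?setIT; first exact: measurableT.
  apply/seteqP; split => // z _; rewrite /= in_itv/= andbT.
  by apply: le_trans (dist_weight_ge0 _ _ _); rewrite lee_fin.
rewrite (_ : _ @^-1` _ = [set z | (set_dist z E `^ a <= t^-1%:E)%E]).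
  exact: emeasurable_fun_infty_c.
apply/seteqP; split => z /=; rewrite in_itv/= andbT;
  by rewrite inve_pge ?inE ?lee_fin ?(ltW t0) ?poweR_ge0// inver gt_eqF.
Qed.

End dist_weight.

Lemma le_powRN {R : realType} (a s t : R) : 0 <= a -> 0 < s -> s <= t ->
  t `^ (- a) <= s `^ (- a).
Proof.
move=> a0 s0 st; have t0 := lt_le_trans s0 st.
rewrite !powRN lef_pV2 ?posrE ?powR_gt0//.
by rewrite ge0_ler_powR ?nnegrE ?(ltW s0) ?(ltW t0).
Qed.

(** * A_1 weights yield weakly porous sets *)

Section A1_porous.
Context {d : measure_display} {R : realType}.
Context {X : completeMetricMeasurableType d R}.
Context {mu : {measure set X -> \bar R}} {C : R} (muC : doubling_with mu C).
Implicit Types (x y z : X) (r s t : R).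

Let mball x r : measurable (ball x r). Proof. exact: (measurable_ball_doubling muC). Qed.

(** A ball has positive measure, so no null set contains it. *)
Lemma ae_ball_exists x r (P : X -> Prop) : 0 < r ->
  (\forall z \ae mu, P z) -> exists2 z, ball x r z & P z.
Proof.
move=> r0 [N [mN N0 PN]]; apply: contrapT => noP.
suff : (mu (ball x r) <= mu N)%E by rewrite N0 leNgt (mu_ball_gt0 muC).
apply: le_measure; rewrite ?inE// => z xz; apply: PN => Pz.
by apply: noP; exists z.
Qed.

Context {E : set X} {a : R} (a0 : 0 < a).
Let w := dist_weight E a.

Lemma measurable_dist_weight_on (D : set X) : measurable_fun D w.
Proof.
apply: measurable_funTS; apply: measurable_dist_weight => //.
by case: muC.
Qed.
Let mw (D : set X) : measurable_fun D w. Proof. exact: measurable_dist_weight_on. Qed.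

Lemma neighborhood_le_integral x s t : 0 < t ->
  ((t `^ (- a))%:E * mu (ball x s `&` neighborhood E t)
     <= \int[mu]_(z in ball x s) w z)%E.
Proof.
move=> t0; have mn : measurable (ball x s `&` neighborhood E t).
  by apply: measurableI => //; exact: (measurable_neighborhood muC).
apply: (@le_trans _ _ (\int[mu]_(z in ball x s `&` neighborhood E t) w z)%E).
  rewrite -integral_cst//; apply: ge0_le_integral => //.
  - by move=> z _; rewrite lee_fin powR_ge0.
  - by move=> z [_ zt]; exact: dist_weight_near.
by apply: ge0_subset_integral => // z _; exact: dist_weight_ge0.
Qed.

Context {K : R} (K0 : 0 <= K).
Hypothesis ww : is_weight mu w.
Hypothesis wA1 : forall z r, 0 < r ->
  ((mu (ball z r))^-1 * \int[mu]_(x in ball z r) w x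
     <= K%:E * ess_inf_on mu (ball z r) w)%E.

(* In a ball without holes E is dense, so the weight would be infinite there. *)
Lemma A1_max_hole_gt0 x s : 0 < s -> 0 < max_hole E x s.
Proof.
move=> s0; rewrite lt_neqAle max_hole_ge0 andbT; apply/eqP => h0.
have near0 z t : ball x s z -> 0 < t -> neighborhood E t z.
  rewrite in_ballE => xz t0; apply: contrapT => zt.
  pose u := Num.min t (s - mdist x z).
  have u0 : 0 < u by rewrite lt_min t0 subr_gt0.
  suff : u <= max_hole E x s by rewrite -h0 leNgt u0.
  apply: (@far_le_max_hole _ _ _ _ _ z) => //.
    by rewrite addrC -lerBrDr ge_min lexx orbT.
  by move/(le_neighborhood (t := t)) => H; apply: zt; apply: H; rewrite ge_min lexx.
(* Local integrability makes the weight finite almost everywhere near [x], whereas it is infinite at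
   every point of [ball x s]. *)
have [_ _ /(_ x)[r r0 wr]] := ww.
have rs0 : 0 < Num.min r s by rewrite lt_min r0 s0.
have [z xz /=] := ae_ball_exists x rs0 (integrable_ae (mball x r) wr).
move: xz; rewrite in_ballE lt_min => /andP[xzr xzs].
rewrite in_ballE => /(_ xzr); suff -> : w z = +oo%E by [].
apply/eqP; rewrite -leye_eq.
have := le_dist_weight a0 (lexx 0%E) (_ : (set_dist z E <= 0)%E).
rewrite poweR0r ?gt_eqF// inve0; apply.
apply/lee_addgt0Pr => e e0; rewrite add0e ltW//.
by apply/set_dist_ltP; apply: near0 => //; rewrite in_ballE.
Qed.

(** Take a hole of radius [r > h / 2], where [h] is the hole radius. On the concentric ball of
    radius [r / 2] the distance to [E] is at least [r / 2 > h / 4], and that ball is not null. *)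
Lemma A1_ess_inf_le x s : 0 < s ->
  (ess_inf_on mu (ball x s) w <= ((max_hole E x s / 4) `^ (- a))%:E)%E.
Proof.
move=> s0; have h0 := A1_max_hole_gt0 x s0; apply/ereal_supP => u /= uw.
have [||r [y [hr _ yr]]] := @max_hole_gt _ _ _ E x s (max_hole E x s / 2).
- by lra.
- by lra.
have r20 : 0 < r / 2 by lra.
have [z yz /=] := ae_ball_exists y r20 uw.
have [xz _] : (ball x s `\` E) z by apply: yr; apply: le_ball yz; lra.
move=> /(_ xz) uz; apply: le_trans uz _; rewrite /w.
apply: le_trans (dist_weight_far (t := r / 2) a0 _ _) _ => //.
  apply: (@ball_disjoint_neighborhood _ _ _ y r (r / 2)).
    by move=> v /yr[].
  by rewrite (_ : r - r / 2 = r / 2)//; lra.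
by rewrite lee_fin le_powRN ?(ltW a0)//; lra.
Qed.

Lemma A1_integral_le x s : 0 < s -> (\int[mu]_(z in ball x s) w z
  <= (K * (max_hole E x s / 4) `^ (- a))%:E * mu (ball x s))%E.
Proof.
move=> s0; have := wA1 x s0; have := mu_ball_gt0 muC x s0.
have := mu_ball_fin muC x s; case: (mu _) => // m _; rewrite lte_fin => m0.
rewrite inver gt_eqF// lee_pdivrMl// => /le_trans; apply.
rewrite EFinM muleC; apply: lee_wpmul2r; first by rewrite lee_fin ltW.
by apply: lee_wpmul2l; [rewrite lee_fin|exact: A1_ess_inf_le].
Qed.

(** Chebyshev's bound at height [e * h] is compared with [A1_integral_le]: the powers of [h] cancel,
    and what remains is small with [e]. *)
Lemma A1_neighborhood_le x s e : 0 < s -> 0 < e ->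
  (mu (ball x s `&` neighborhood E (e * max_hole E x s))
     <= (K * (4 * e) `^ a)%:E * mu (ball x s))%E.
Proof.
move=> s0 e0; have h0 := A1_max_hole_gt0 x s0.
set h := max_hole E x s in h0 *; have eh0 : 0 < e * h by rewrite mulr_gt0.
have := le_trans (neighborhood_le_integral x s eh0) (A1_integral_le x s0).
have p0 : 0 < (e * h) `^ a by rewrite powR_gt0.
rewrite powRN lee_pdivrMl// => /le_trans; apply.
rewrite muleA -EFinM; apply: lee_wpmul2r => //; rewrite lee_fin -/h.
rewrite mulrCA ler_wpM2l// powRN ler_pdivrMr ?powR_gt0 ?divr_gt0//.
rewrite -powRM; [|lra..].
by rewrite (_ : 4 * e * (h / 4) = e * h)//; field.
Qed.

Lemma A1_weakly_porous : weakly_porous mu E.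
Proof.
have [C1 _ _] := muC; have C0 : 0 < C by lra.
pose k := (2 * C * (K + 1))^-1.
have CK : 2 <= 2 * C * (K + 1).
  by have := mulr_ge0 (ltW C0) K0; lra.
have k0 : 0 < k by rewrite invr_gt0; lra.
have k1 : k <= 1 by rewrite invf_le1; lra.
have kK : K * k <= (2 * C)^-1.
  rewrite /k invfM mulrCA ler_piMr ?invr_ge0 ?mulr_ge0 ?(ltW C0)//.
  by rewrite ler_pdivrMr; [rewrite mul1r lerDl|rewrite ltr_wpDl].
clearbody k; pose e := k `^ a^-1 / 4.
have ka0 : 0 < k `^ a^-1 by rewrite powR_gt0.
have ka1 : k `^ a^-1 <= 1.
  have : k `^ a^-1 <= 1 `^ a^-1.
    by apply: ge0_ler_powR; rewrite ?nnegrE ?invr_ge0 ?(ltW a0) ?(ltW k0).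
  by rewrite powR1.
have eE : (4 * e) `^ a = k.
  rewrite /e mulrCA divff// mulr1 -powRrM mulVf ?gt_eqF// powRr1//.
  exact: ltW.
(* In the porosity constant, one [C] pays for halving the radius, [C ^+ 2] for the Vitali covering,
   and 2 for discarding the points close to [E]. *)
exists (2 * C ^+ 3)^-1, e; split.
- have : 1 <= C ^+ 3 by rewrite exprn_ege1.
  by move=> H; rewrite invr_gt0 invf_lt1; lra.
- by rewrite /e; lra.
move=> x s s0; have h0 := A1_max_hole_gt0 x s0.
have h2 := max_hole_le2 E x (ltW s0).
set h := max_hole E x s in h0 h2 *; pose t := e * h.
have t0 : 0 < t by rewrite /t /e mulr_gt0//; lra.
have t2 : t <= s / 2.
  have : e * h <= 4^-1 * (2 * s) by apply: ler_pM; rewrite /e//; lra.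
  by rewrite /t; lra.
(* Since [t <= s / 2], the [t]-balls centered in [G] stay in [ball x s], and they miss [E]. *)
pose G := ball x (s / 2) `\` neighborhood E t.
have mn : measurable (neighborhood E t) by exact: (measurable_neighborhood muC).
have mG : measurable G by exact: measurableD.
have Gball y : G y -> ball y t `<=` ball x s `\` E.
  move=> [+ yt] z yz; rewrite in_ballE => xy; split.
    by apply: subset_ball yz; lra.
  by move=> Ez; apply: yt; exists z => //; move: yz; rewrite in_ballE.
have [|l [lG ldisj Gl]] := doubling_vitali (M := t) muC (x := x) (r := s)
    (s := fun=> t) mG t0.
  by move=> y /Gball ys; split => // z /ys[].
exists (size l), (tnth (in_tuple l)), (fun=> t); split.
- by [].
- move=> i j; wlog ij : i j / (i < j)%N => [H|_].
    rewrite neq_ltn => /orP[ij|ji]; first by apply: H => //; rewrite neq_ltn ij.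
    by rewrite setIC; apply: H => //; rewrite neq_ltn ji.
  apply/asboolP; rewrite !(tnth_nth x).
  by move/(pairwiseP x): ldisj; apply; rewrite ?inE.
- by move=> i; apply/Gball/lG; exact: mem_tnth.
- by move=> _; rewrite -/h lexx /=; lra.
rewrite big_tnth in Gl.
set S := (\sum_(i < _) _)%E in Gl *.
have S_ge0 : (0 <= S)%E by exact: sume_ge0.
have half : (mu (ball x s) <= C%:E * mu (ball x (s / 2)))%E.
  have := mu_ball_pow2 muC 1 x (r := s / 2).
  by rewrite !expr1 (_ : 2 * (s / 2) = s); [apply; lra|field].
have split : (mu (ball x (s / 2)) <= mu G + (K * k)%:E * mu (ball x s))%E.
  rewrite (measureDI mu (mball _ _) mn) leeD2l// -eE.
  apply: le_trans _ (A1_neighborhood_le x s0 _); last by rewrite /e; lra.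
  apply: le_measure; rewrite ?inE; [exact: measurableI|exact: measurableI|].
  by apply: setSI; apply: le_ball; lra.
have Gfin : mu G \is a fin_num.
  by apply: (mu_ball_fin_sub muC (x := x) (r := s / 2)) => // z [].
have := fineK Gfin; have := fineK (mu_ball_fin muC x s).
have := fineK (mu_ball_fin muC x (s / 2)).
set b' := fine _; set b := fine _; set g := fine _ => b'E bE gE.
have b0 : 0 <= b by rewrite /b fine_ge0.
move: Gl half split S_ge0; rewrite -b'E -bE -gE.
case: S => [S| |]//=; last by move=> *; rewrite leey.
rewrite -!EFinM -!EFinD !lee_fin => Gl half split S_ge0.
have Kkb : K * k * b <= (2 * C)^-1 * b by exact: ler_wpM2r.
rewrite ler_pdivrMl ?mulr_gt0 ?exprn_gt0//.
have Cb : C * b' <= C * (C ^+ 2 * S + (2 * C)^-1 * b).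
  by rewrite ler_wpM2l ?(ltW C0)//; lra.
have -> : 2 * C ^+ 3 * S = 2 * (C * (C ^+ 2 * S)) by ring.
have : C * ((2 * C)^-1 * b) = b / 2 by field; rewrite gt_eqF.
lra.
Qed.

Lemma A1_max_hole_doubling : max_hole_doubling E.
Proof.
have [C1 _ _] := muC; have C0 : 0 < C by lra.
pose Q := K * C ^+ 2.
have Q0 : 0 <= Q by rewrite mulr_ge0// exprn_ge0// ltW.
(* The 8 serves the case [s / 2 <= h], where [H <= 4 * s <= 8 * h]; the other term comes from the
   comparison of integrals. *)
pose D := Num.max 8 (8 * Q `^ a^-1).
exists D; first by rewrite lt_max; apply/orP; left.
move=> x s s0; have s20 : 0 < 2 * s by lra.
have h0 := A1_max_hole_gt0 x s0; have H0 := A1_max_hole_gt0 x s20.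
have H2 := max_hole_le2 E x (ltW s20).
set h := max_hole E x s in h0 *; set H := max_hole E x (2 * s) in H0 H2 *.
have [hs|hs] := leP (s / 2) h.
  apply: (@le_trans _ _ (8 * h)); first by lra.
  by apply: ler_wpM2r; [lra|rewrite le_max lexx].
(* Slightly above the hole radius: each point of [ball x (s / 2)] is then within [t] of [E], or a
   hole of radius [t > h] would fit into [ball x s]. *)
pose t := Num.min (2 * h) (s / 2).
have ht : h < t by rewrite /t lt_min hs andbT; lra.
have t0 : 0 < t by lra.
have ts : t <= s / 2 by rewrite /t ge_min lexx orbT.
have th : t <= 2 * h by rewrite /t ge_min lexx.
have sub : ball x (s / 2) `<=` ball x (2 * s) `&` neighborhood E t.
  move=> z xz; split; first by apply: le_ball xz; lra.
  move: xz; rewrite in_ballE => xz; apply: contrapT => zt.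
  suff : t <= h by lra.
  by apply: far_le_max_hole zt => //; lra.
have mn : measurable (neighborhood E t) by exact: (measurable_neighborhood muC).
have tQ : t `^ (- a) <= Q * (H / 4) `^ (- a).
  have low := neighborhood_le_integral x (2 * s) t0.
  have := le_trans low (A1_integral_le x s20); rewrite -/H => up.
  have m0 : 0 < fine (mu (ball x (s / 2))).
    by rewrite fine_gt0// (mu_ball_gt0 muC) ?divr_gt0//= ltey_eq (mu_ball_fin muC).
  rewrite -(ler_pM2r m0) -lee_fin EFinM (fineK (mu_ball_fin muC _ _)).
  apply: (@le_trans _ _ ((t `^ (- a))%:E *
      mu (ball x (2 * s) `&` neighborhood E t))%E).
    apply: lee_wpmul2l; first by rewrite lee_fin powR_ge0.
    by apply: le_measure; rewrite ?inE//; exact: measurableI.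
  apply: le_trans up _; rewrite [leRHS]EFinM (fineK (mu_ball_fin muC _ _)).
  have := mu_ball_pow2 muC 2 x (r := s / 2).
  rewrite (_ : 2 ^+ 2 * (s / 2) = 2 * s); last by field.
  move=> /(_ (divr_gt0 s0 (ltr0Sn _ 1))) m2.
  apply: le_trans (lee_wpmul2l _ m2) _.
    by rewrite lee_fin mulr_ge0// powR_ge0.
  by rewrite muleA -EFinM /Q mulrAC.
have Ha : (H / 4) `^ a <= Q * t `^ a.
  have := tQ; rewrite !powRN ler_pdivlMr ?powR_gt0 ?divr_gt0//.
  by rewrite mulrC ler_pdivrMr ?powR_gt0.
have HQ : H / 4 <= Q `^ a^-1 * t.
  have H4 : 0 <= H / 4 by lra.
  have : ((H / 4) `^ a) `^ a^-1 <= (Q * t `^ a) `^ a^-1.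
    apply: ge0_ler_powR; rewrite ?nnegrE ?invr_ge0 ?(ltW a0) ?powR_ge0//.
    by rewrite mulr_ge0// powR_ge0.
  rewrite (powRM _ Q0 (powR_ge0 _ _)) -!powRrM divff ?gt_eqF// !powRr1//.
  exact: ltW.
have Qt : Q `^ a^-1 * t <= Q `^ a^-1 * (2 * h) by rewrite ler_wpM2l// powR_ge0.
apply: (@le_trans _ _ (8 * Q `^ a^-1 * h)); first by lra.
by apply: ler_wpM2r; [lra|rewrite le_max lexx orbT].
Qed.

End A1_porous.

(** * Weakly porous sets yield A_1 weights *)

Section layer_cake.
Context {d : measure_display} {R : realType}.
Context {X : completeMetricMeasurableType d R}.
Context {E : set X} {a : R} (a0 : 0 < a).
Context {T : nat -> R} (T0 : forall k, 0 < T k) (T_le : forall k, T k <= T 0).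

Let layer k (z : X) : \bar R :=
  ((T k.+1 `^ (- a))%:E * (\1_(neighborhood E (T k)) z)%:E)%E.

Let layer_ge0 k z : (0 <= layer k z)%E.
Proof. by rewrite /layer -EFinM lee_fin mulr_ge0 ?powR_ge0. Qed.

(* A point of closure E lies in every neighborhood: both sides are infinite. *)
Lemma dist_weight_le_layers z : (dist_weight E a z
  <= (T 0 `^ (- a))%:E + \sum_(0 <= k <oo) layer k z)%E.
Proof.
have lim_ge n : (\sum_(0 <= k < n) layer k z <= \sum_(0 <= k <oo) layer k z)%E.
  by apply: nneseries_lim_ge => k _ _.
have L0 : (0 <= (T 0 `^ (- a))%:E)%E by rewrite lee_fin powR_ge0.
have [ex|all_near] := pselect (exists k, ~ neighborhood E (T k) z).
  have exb : exists k, `[< ~ neighborhood E (T k) z >].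
    by case: ex => k kz; exists k; apply/asboolP.
  (* At the first radius whose neighborhood misses [z], either the index is 0 and the constant term
     suffices, or the preceding layer contains [z]. *)
  case: (ex_minnP exb) => -[|k] /asboolP far kmin.
    apply: le_trans (dist_weight_far a0 (T0 0) far) _.
    by rewrite leeDl// nneseries_ge0.
  have near : neighborhood E (T k) z.
    by apply: contrapT => /asboolP/kmin; rewrite ltnn.
  apply: le_trans (dist_weight_far a0 (T0 k.+1) far) _.
  apply: le_trans (leeDr _ L0); apply: le_trans (lim_ge k.+1).
  rewrite big_nat_recr//= {2}/layer indicE mem_set// mule1 leeDr//.
  by apply: sume_ge0.
have near k : neighborhood E (T k) z.
  by apply: contrapT => kz; apply: all_near; exists k.
suff -> : (\sum_(0 <= k <oo) layer k z = +oo)%E by rewrite addey ?leey.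
apply/eqyP => A A0.
(* Every layer contributes at least [L], so the partial sums exceed any [A]. *)
pose L := T 0 `^ (- a); have Lp : 0 < L by rewrite powR_gt0.
apply: le_trans (lim_ge (Num.truncn (A / L)).+1).
apply: (@le_trans _ _ (\sum_(0 <= k < (Num.truncn (A / L)).+1) L%:E)%E).
  rewrite sumEFin lee_fin sumr_const_nat subn0 -mulr_natl -ler_pdivrMr//.
  exact/ltW/truncnS_gt.
apply: lee_sum => k _; rewrite /layer indicE mem_set// mule1 lee_fin.
by apply: le_powRN => //; exact: ltW.
Qed.

Lemma integral_dist_weight_le (mu : {measure set X -> \bar R}) (U : set X) :
  (forall V : set X, open V -> measurable V) -> measurable U ->
  (\int[mu]_(z in U) dist_weight E a z <= (T 0 `^ (- a))%:E * mu U +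
    \sum_(0 <= k <oo) (T k.+1 `^ (- a))%:E * mu (neighborhood E (T k) `&` U))%E.
Proof.
move=> mo mU; have mn t : measurable (neighborhood E t).
  exact/mo/neighborhood_open.
have ml k : measurable_fun U (layer k).
  apply: emeasurable_funM => //; exact/measurable_EFinP/measurable_indic.
have mS : measurable_fun U (fun z => \sum_(0 <= k <oo) layer k z)%E.
  exact: ge0_emeasurable_sum.
have S0 z : (0 <= \sum_(0 <= k <oo) layer k z)%E by exact: nneseries_ge0.
apply: (@le_trans _ _ (\int[mu]_(z in U)
    ((T 0 `^ (- a))%:E + \sum_(0 <= k <oo) layer k z))%E).
  apply: ge0_le_integral => //.
  - by move=> z _; exact: dist_weight_ge0.
  - by apply: measurable_funTS; exact: measurable_dist_weight.
  - exact: emeasurable_funD.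
  - by move=> z _; exact: dist_weight_le_layers.
rewrite ge0_integralD//; last by move=> z _; rewrite lee_fin powR_ge0.
rewrite -integral_cst// leeD2l// integral_nneseries//.
apply: lee_nneseries => [k _ _|k _]; first by apply: integral_ge0.
rewrite ge0_integralZl_EFin ?powR_ge0//.
- by rewrite integral_indic.
- exact/measurable_EFinP/measurable_indic.
Qed.

End layer_cake.

Lemma geometric_nneseries_le {R : realType} (A r : R) : 0 <= A -> 0 <= r ->
  r < 1 -> (\sum_(0 <= k <oo) (A * r ^+ k)%:E <= (A / (1 - r))%:E)%E.
Proof.
move=> A0 r0 r1; apply: lime_le.
  by apply: is_cvg_nneseries => k _ _; rewrite lee_fin mulr_ge0// exprn_ge0.
apply: nearW => n; rewrite sumEFin lee_fin -mulr_sumr ler_wpM2l//.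
rewrite -[leRHS]div1r ler_pdivlMr ?subr_gt0// big_mkord.
have := subrX1 r n; have := exprn_ge0 n r0.
by move=> ? rn; lra.
Qed.

(** * Geometric decay of the measure of neighborhoods, and the resulting A_1 bound *)

Section porous_decay.
Context {d : measure_display} {R : realType}.
Context {X : completeMetricMeasurableType d R}.
Context {mu : {measure set X -> \bar R}} {C : R} (muC : doubling_with mu C).
Implicit Types (x y z : X) (r s t : R).

Let mball x r : measurable (ball x r). Proof. exact: (measurable_ball_doubling muC). Qed.
Let C1 : 1 <= C. Proof. by case: muC. Qed.
Let C0 : 0 < C. Proof. exact: lt_le_trans C1. Qed.

Context {E : set X}.
Let mnbhd t : measurable (neighborhood E t).
Proof. exact: (measurable_neighborhood muC). Qed.

Context {c delta : R} (c0 : 0 < c) (delta0 : 0 < delta).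
Hypothesis porous : forall x s, 0 < s ->
  exists (N : nat) (y : 'I_N -> X) (r : 'I_N -> R),
    [/\ forall i, 0 < r i,
        forall i j, i != j -> ball (y i) (r i) `&` ball (y j) (r j) = set0,
        forall i, ball (y i) (r i) `<=` ball x s `\` E,
        forall i, delta * max_hole E x s <= r i <= 2 * s
      & (c%:E * mu (ball x s) <= \sum_(i < N) mu (ball (y i) (r i)))%E].

(** The family given by porosity has positive total measure, so it is nonempty, and each member is a
    hole. *)
Lemma porous_max_hole_gt0 x s : 0 < s -> 0 < max_hole E x s.
Proof.
move=> s0; have [N [y [r [r0 _ yE rs]]]] := porous x s0.
case: N y r r0 yE rs => [|N] y r r0 yE rs.
  by rewrite big_ord0 leNgt mule_gt0 ?lte_fin ?(mu_ball_gt0 muC).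
move=> _; apply: lt_le_trans (r0 ord0) _.
by apply: max_hole_ge (yE ord0) => //; have /andP[] := rs ord0.
Qed.

(** Halving the porosity balls puts their points at distance at least [delta * h / 2] from [E] and
    costs one doubling constant. *)
Lemma porous_far_part x s t : 0 < s -> t <= delta * max_hole E x s / 2 ->
  (c%:E * mu (ball x s) <= C%:E * mu (ball x s `\` neighborhood E t))%E.
Proof.
move=> s0 ts; have [N [y [r [r0 disj yE rs cs]]]] := porous x s0.
apply: le_trans cs _.
apply: (@le_trans _ _ (\sum_(i < N) C%:E * mu (ball (y i) (r i / 2)))%E).
  apply: lee_sum => i _; have := mu_ball_pow2 muC 1 (y i) (r := r i / 2).
  by rewrite !expr1 (_ : 2 * (r i / 2) = r i); [apply; rewrite divr_gt0|field].
rewrite -ge0_sume_distrr//; apply: lee_wpmul2l; first by rewrite lee_fin ltW.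
have half i : ball (y i) (r i / 2) `<=` ball (y i) (r i).
  by apply: le_ball; have := r0 i; lra.
apply: (@sum_measure_le _ _ _ mu _ _ (fun i => ball (y i) (r i / 2))) => //.
- exact: measurableD.
- move=> i _ z iz; split; first by have [] := yE i z (half i z iz).
  apply: (@ball_disjoint_neighborhood _ _ E (y i) (r i) t).
    by move=> u /yE[].
  by apply: le_ball iz; have /andP[+ _] := rs i; have := r0 i; lra.
apply: (@sub_pairwise _ (fun i j => i != j)); last first.
  by rewrite -uniq_pairwise index_enum_uniq.
move=> i j /disj ij; apply/asboolP; rewrite -subset0 -ij.
by move=> z [/half iz /half jz].
Qed.

Context {D : R} (D2 : 2 <= D).
Hypothesis doubling : forall x s, 0 < s ->
  max_hole E x (2 * s) <= D * max_hole E x s.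

Let D0 : 0 < D. Proof. exact: lt_le_trans D2. Qed.

Lemma max_hole_div_pow2 x s n : 0 < s ->
  max_hole E x s <= D ^+ n * max_hole E x (s / 2 ^+ n).
Proof.
move=> s0; elim: n => [|n IH]; first by rewrite !expr0 mul1r divr1.
apply: le_trans IH _; rewrite exprSr -mulrA ler_wpM2l ?exprn_ge0 ?(ltW D0)//.
have -> : s / 2 ^+ n = 2 * (s / 2 ^+ n.+1).
  by rewrite exprS; field; rewrite gt_eqF// exprn_gt0.
by apply: doubling; rewrite divr_gt0// exprn_gt0.
Qed.

(** The hole radius is at most twice the radius of the ball, so it tends to 0 along the halvings;
    [n.+1] is the first one bringing it down to [t]. *)
Lemma max_hole_scale x s t : 0 < s -> 0 < t -> t < max_hole E x s ->
  exists n, max_hole E x (s / 2 ^+ n.+1) <= t < max_hole E x (s / 2 ^+ n).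
Proof.
move=> s0 t0 ts; have ex : exists n, max_hole E x (s / 2 ^+ n) <= t.
  pose n := (Num.truncn (2 * s / t)).+1; exists n.
  have n0 : 0 < 2 ^+ n :> R by rewrite exprn_gt0.
  apply: le_trans (max_hole_le2 _ _ _) _; first by rewrite divr_ge0// ltW.
  rewrite mulrA ler_pdivrMr// [leRHS]mulrC -ler_pdivrMr//.
  apply: le_trans (ltW (truncnS_gt _)) _.
  by rewrite -natrX ler_nat ltnW// ltn_expl.
case: (ex_minnP ex) => -[|n] nt nmin.
  by move: nt; rewrite expr0 divr1 leNgt ts.
by exists n; rewrite nt ltNge; apply/negP => /nmin; rewrite ltnn.
Qed.

(* A ball [ball y s] as in the last hypothesis is contained in the
   (2 D t)-neighborhood of E, but by porosity a fixed fraction of it avoids the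
   u-neighborhood; sum this over a Vitali family of such balls. *)
Lemma neighborhood_step x (r e t u : R) : 0 < t ->
  u <= t -> u <= delta * t / (2 * D) ->
  (forall y, ball x r y -> exists s, [/\ 0 < s, s <= e
    & max_hole E y s <= t <= D * max_hole E y s]) ->
  (mu (ball x r `&` neighborhood E u) <= (C ^+ 3 / c)%:E *
    mu ((ball x (r + e) `&` neighborhood E (2 * D * t)) `\` neighborhood E u))%E.
Proof.
move=> t0 ut uD scale.
have /choice[s sE] : forall y, exists s, ball x r y -> [/\ 0 < s, s <= e
    & max_hole E y s <= t <= D * max_hole E y s].
  move=> y; have [/scale[s ?]|xy] := pselect (ball x r y); first by exists s.
  by exists 0.
set A := ball x r `&` _; set U := _ `&` neighborhood E (2 * D * t).
have mA : measurable A by exact: measurableI.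
have mU : measurable U by exact: measurableI.
have sU y : A y -> ball y (s y) `<=` U.
  move=> [xy yu] z yz; have [s0 se /andP[ht _]] := sE y xy.
  split; first by apply: subset_ball yz; move: xy; rewrite in_ballE; lra.
  move: yz; rewrite in_ballE => yz.
  have hD := doubling y s0.
  have hDt : max_hole E y (2 * s y) <= D * t.
    by apply: le_trans hD _; rewrite ler_wpM2l// ltW.
  have t2 : 2 * t <= D * t by rewrite ler_wpM2r// ltW.
  (* A small ball stays close to [y], which is within [u <= t] of [E]. In a large one, a point too
     far from [E] would give a hole of radius above [D * t] in the doubled ball. *)
  have [sD|sD] := leP (s y) (D * t).
    by apply: (neighborhood_near yu); rewrite metric_sym; lra.
  apply: contrapT => zt.
  have Dt0 : 0 < D * t by rewrite mulr_gt0.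
  pose v := Num.min (2 * (D * t)) (s y).
  have vD : D * t < v by rewrite lt_min sD andbT; lra.
  have vs : v <= s y by rewrite ge_min lexx orbT.
  suff : v <= max_hole E y (2 * s y) by lra.
  apply: (@far_le_max_hole _ _ _ _ _ z); [lra|lra|move=> zv; apply: zt].
  by apply: le_neighborhood zv; rewrite -mulrA ge_min lexx.
(* Vitali needs radii bounded below: [t] is at most [D] times the hole radius, which is at most
   [2 * s y]. *)
have s_ge y : A y -> t / (2 * D) <= s y.
  move=> [xy _]; have [s0 _ /andP[_ tD]] := sE y xy.
  rewrite ler_pdivrMr ?mulr_gt0//; apply: le_trans tD _.
  rewrite (_ : s y * (2 * D) = D * (2 * s y)); last by ring.
  by rewrite ler_wpM2l ?(ltW D0)//; apply: max_hole_le2; exact: ltW.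
have e0 : 0 < t / (2 * D) by rewrite divr_gt0// mulr_gt0.
have [|l [lA ldisj Al]] := doubling_vitali (s := s) (M := e) muC (x := x)
    (r := r + e) mA e0.
  move=> y Ay; have [xy _] := Ay; have [s0 se _] := sE y xy.
  by split => //; [exact: s_ge|move=> z /(sU y Ay)[]].
apply: le_trans Al _.
(* [C ^+ 2] is the Vitali constant and [C / c] comes from [porous_far_part]. *)
have -> : (C ^+ 3 / c)%:E = ((C ^+ 2)%:E * (C / c)%:E)%E.
  by rewrite -EFinM; congr (_%:E); ring.
rewrite -muleA.
apply: lee_wpmul2l; first by rewrite lee_fin exprn_ge0// ltW.
apply: (@le_trans _ _ ((C / c)%:E *
    \sum_(y <- l) mu (ball y (s y) `\` neighborhood E u))%E).
  rewrite ge0_sume_distrr// big_seq [leRHS]big_seq; apply: lee_sum => y /lA[xy _].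
  have [s0 se /andP[ht tD]] := sE y xy.
  have uh : u <= delta * max_hole E y (s y) / 2.
    apply: le_trans uD _; rewrite ler_pdivrMr ?mulr_gt0//.
    have -> : delta * max_hole E y (s y) / 2 * (2 * D) =
      delta * (D * max_hole E y (s y)) by field.
    by rewrite ler_wpM2l// ltW.
  have := porous_far_part s0 uh; rewrite -lee_pdivlMl// => /le_trans; apply.
  by rewrite muleA -EFinM (mulrC c^-1).
apply: lee_wpmul2l; first by rewrite lee_fin divr_ge0// ltW.
apply: sum_measure_le.
- exact: measurableD.
- by move=> y _; exact: measurableD.
- by move=> y /lA Ay; apply: setSD; exact: sU.
apply: sub_pairwise ldisj => y z /asboolP yz; apply/asboolP.
by rewrite -subset0 -yz => v [[? _] [? _]].
Qed.

Let theta := C ^+ 3 / (c + C ^+ 3).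

(* Adding [C ^+ 3 / c] times the left-hand side to [neighborhood_step] (the
   hole-filling trick) turns it into a contraction. *)
Lemma neighborhood_contract x (r e t u : R) : 0 < t -> 0 <= e ->
  u <= t -> u <= delta * t / (2 * D) ->
  (forall y, ball x r y -> exists s, [/\ 0 < s, s <= e
    & max_hole E y s <= t <= D * max_hole E y s]) ->
  (mu (ball x r `&` neighborhood E u)
     <= theta%:E * mu (ball x (r + e) `&` neighborhood E (2 * D * t)))%E.
Proof.
move=> t0 e0 ut uD scale; have := neighborhood_step t0 ut uD scale.
set A := ball x r `&` _; set U := _ `&` neighborhood E (2 * D * t).
set N := neighborhood E u; have mN : measurable N by exact: mnbhd.
have mA : measurable A by exact: measurableI.
have mU : measurable U by exact: measurableI.
have t2D : u <= 2 * D * t.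
  have : 2 * t <= D * t by rewrite ler_wpM2r// ltW.
  by rewrite -mulrA; lra.
have AUN : A `<=` U `&` N.
  move=> z [xz zu]; split => //; split; first by apply: le_ball xz; lra.
  exact: le_neighborhood zu.
have lee1 : (mu A <= mu (U `&` N))%E.
  by apply: le_measure; rewrite ?inE//; exact: measurableI.
have Afin : mu A \is a fin_num.
  by apply: (mu_ball_fin_sub muC (x := x) (r := r)) => // z [].
have Ufin : mu U \is a fin_num.
  by apply: (mu_ball_fin_sub muC (x := x) (r := r + e)) => // z [].
have mUN : measurable (U `\` N) by exact: measurableD.
have UNfin : mu (U `\` N) \is a fin_num.
  by apply: (mu_ball_fin_sub muC (x := x) (r := r + e)) => // z [[]].
have mUI : measurable (U `&` N) by exact: measurableI.
have UIfin : mu (U `&` N) \is a fin_num.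
  by apply: (mu_ball_fin_sub muC (x := x) (r := r + e)) => // z [[]].
have UE : mu U = (mu (U `\` N) + mu (U `&` N))%E by exact: measureDI.
move: lee1 UE.
rewrite -(fineK Afin) -(fineK UIfin) -(fineK UNfin) -(fineK Ufin).
set a := fine (mu A); set b := fine (mu U); set b1 := fine (mu (U `\` N)).
set b2 := fine (mu (U `&` N)).
rewrite -EFinD -!EFinM !lee_fin => ab2 [bE] aK.
have C3 : 0 < C ^+ 3 by rewrite exprn_gt0.
rewrite /theta mulrAC ler_pdivlMr ?addr_gt0//.
have : a * c <= C ^+ 3 * b1 by rewrite -ler_pdivlMr// mulrAC.
have : C ^+ 3 * a <= C ^+ 3 * b2 by rewrite ler_pM2l.
by rewrite bE; lra.
Qed.

Context {m : nat} (m0 : (0 < m)%N) (delta1 : delta <= 1).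
Hypothesis Dm : 4 * D ^+ 2 <= delta * D ^+ m.

(* Doubling of the hole radius forces the covering balls of generation k to have
   radius at most [s / 2 ^+ k]; these enlargements sum to at most [2 * s]. *)
Lemma neighborhood_decay x s k : 0 < s ->
  (mu (ball x (s + 2 * s / 2 ^+ k) `&`
       neighborhood E (max_hole E x s / D ^+ (m * k)))
     <= (theta ^+ k)%:E * mu (ball x (3 * s)))%E.
Proof.
move=> s0; elim: k => [|k IH].
  rewrite expr0 mul1e divr1; apply: le_measure; rewrite ?inE//.
    exact: measurableI.
  by move=> z [xz _]; apply: le_ball xz; lra.
have theta0 : 0 <= theta.
  by rewrite /theta divr_ge0// ?addr_ge0 ?exprn_ge0// ltW.
rewrite (exprS theta) EFinM -muleA.
apply: le_trans _ (lee_wpmul2l _ IH); last by rewrite lee_fin.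
set H := max_hole E x s; have H0 : 0 < H by exact: porous_max_hole_gt0.
have P0 : 0 < D ^+ (m * k) by rewrite exprn_gt0.
set P := D ^+ (m * k) in P0 *.
(* Chosen so that [2 * D * t] is the neighborhood radius of generation [k]. *)
pose t := H / P / (2 * D).
have t0 : 0 < t by rewrite /t !divr_gt0// mulr_gt0.
have tHP : H / P = 2 * D * t by rewrite /t [RHS]mulrC divfK// gt_eqF// mulr_gt0.
clearbody t; have Ht : H = 2 * D * t * P by rewrite -tHP divfK// gt_eqF.
have e0 : 0 < s / 2 ^+ k by rewrite divr_gt0// exprn_gt0.
have -> : s + 2 * s / 2 ^+ k = s + 2 * s / 2 ^+ k.+1 + s / 2 ^+ k.
  by rewrite exprS; field; rewrite gt_eqF// exprn_gt0.
have es : s / 2 ^+ k <= s.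
  by rewrite ler_pdivrMr ?exprn_gt0// ler_peMr ?(ltW s0)// exprn_ege1 ?ler1n.
have rE : 2 * s / 2 ^+ k.+1 = s / 2 ^+ k.
  by rewrite exprS; field; rewrite gt_eqF// exprn_gt0.
have Dm0 : 0 < D ^+ m by rewrite exprn_gt0.
have D20 : 0 < D ^+ 2 by rewrite exprn_gt0.
have uE : H / D ^+ (m * k.+1) = 2 * D * t / D ^+ m.
  by rewrite mulnS exprD -/P Ht; field; rewrite !gt_eqF.
(* Here [Dm] enters: the ratio [D ^+ m] between generations is large enough for the contraction. *)
have uD : H / D ^+ (m * k.+1) <= delta * t / (2 * D).
  rewrite uE ler_pdivrMr//.
  have -> : delta * t / (2 * D) * D ^+ m = (delta * D ^+ m) * (t / (2 * D)) by ring.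
  apply: le_trans _ (ler_wpM2r _ Dm); last first.
    by rewrite divr_ge0 ?mulr_ge0 ?(ltW t0) ?(ltW D0).
  by rewrite (_ : 4 * D ^+ 2 * (t / (2 * D)) = 2 * D * t)//; field; rewrite gt_eqF.
have ut : H / D ^+ (m * k.+1) <= t.
  apply: le_trans uD _; rewrite ler_pdivrMr ?mulr_gt0// mulrC ler_wpM2l ?(ltW t0)//.
  by move: D2 delta1; lra.
rewrite tHP; apply: neighborhood_contract => //; first exact: ltW.
move=> y; rewrite in_ballE rE => xy.
have s40 : 0 < 4 * s by lra.
(* As [y] is within [2 * s] of [x], the ball of radius [4 * s] at [y] contains [ball x s], so its
   halvings cross the level [t]. *)
have Hy : H <= max_hole E y (4 * s).
  by apply: le_max_hole; [lra|apply: subset_ball; rewrite metric_sym; lra].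
have tH : t < H.
  have P1 : 1 <= P by rewrite exprn_ege1//; move: D2; lra.
  have : t * 1 <= t * P by rewrite ler_wpM2l// ltW.
  have : 2 * (t * P) <= D * (t * P) by rewrite ler_wpM2r// mulr_ge0// ltW.
  rewrite Ht (_ : 2 * D * t * P = 2 * (D * (t * P))); last by ring.
  by lra.
have [n /andP[nt tn]] := max_hole_scale s40 t0 (lt_le_trans tH Hy).
have n20 : 0 < 4 * s / 2 ^+ n.+1 by rewrite divr_gt0// exprn_gt0.
exists (4 * s / 2 ^+ n.+1); split => //; last first.
  rewrite nt/=; apply: le_trans (ltW tn) _.
  rewrite (_ : 4 * s / 2 ^+ n = 2 * (4 * s / 2 ^+ n.+1)); first exact: doubling.
  by rewrite exprS; field; rewrite gt_eqF// exprn_gt0.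
(* If [n <= k], then [n.+1] doublings give [H <= D ^+ n.+1 * t <= P * D * t], which is [H / 2]. The
   strict inequality absorbs the factor 4 in [4 * s]. *)
have kn : (k < n)%N.
  rewrite ltnNge; apply/negP => nk.
  have Dn0 : 0 < D ^+ n by rewrite exprn_gt0.
  have nP : D ^+ n <= P.
    apply: ler_weXn2l; first by move: D2; lra.
    by apply: leq_trans nk _; rewrite leq_pmull.
  have := max_hole_div_pow2 y n.+1 s40.
  have : D ^+ n.+1 * max_hole E y (4 * s / 2 ^+ n.+1) <= D ^+ n.+1 * t.
    by rewrite ler_wpM2l// exprn_ge0// ltW.
  have : D ^+ n * (D * t) <= P * (D * t).
    by rewrite ler_wpM2r// mulr_ge0// ltW.
  have : 0 < P * (D * t) by rewrite !mulr_gt0.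
  rewrite exprS (_ : D * D ^+ n * t = D ^+ n * (D * t)); last by ring.
  by move: Hy; rewrite Ht; lra.
rewrite ler_pdivrMr ?exprn_gt0// mulrAC ler_pdivlMr ?exprn_gt0//.
rewrite [leLHS]mulrAC mulrC ler_wpM2l ?(ltW s0)//.
rewrite (_ : 4 = 2 ^+ 2)//; last by ring.
rewrite -exprD ler_weXn2l//.
by lra.
Qed.

Context {eta a : R} (eta0 : 0 < eta) (eta1 : eta < 1) (a0 : 0 < a).
Hypothesis eta_theta : eta ^+ 2 = theta.
Hypothesis Da : (D ^+ m) `^ a = eta^-1.

(** The 1 accounts for points at distance at least [h] from [E]. In the rest, [C ^+ 2] compares
    [ball x (3 * s)] with [ball x s], [eta^-1] is due to the index shift in [T k.+1], and
    [(1 - eta)^-1] is the geometric sum. *)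
Let bound := 1 + C ^+ 2 / (eta * (1 - eta)).

(** On generation [k] the weight grows like [eta ^- k] while the measure decays like [theta ^+ k],
    the square of [eta ^+ k]; the products form a geometric series. *)
Lemma porous_integral_le x s : 0 < s -> (\int[mu]_(z in ball x s) dist_weight E a z
  <= (bound * max_hole E x s `^ (- a))%:E * mu (ball x s))%E.
Proof.
move=> s0; set h := max_hole E x s; have h0 : 0 < h by exact: porous_max_hole_gt0.
pose T k := h / D ^+ (m * k).
have P0 k : 0 < D ^+ (m * k) by rewrite exprn_gt0.
have T0 k : 0 < T k by rewrite divr_gt0.
have T00 : T 0%N = h by rewrite /T muln0 expr0 divr1.
have T_le k : T k <= T 0%N.
  rewrite T00 ler_pdivrMr// ler_peMr ?(ltW h0)// exprn_ege1//.
  by move: D2; lra.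
have TE k : T k `^ (- a) = h `^ (- a) * eta ^- k.
  have : h `^ a = T k `^ a * eta ^- k.
    rewrite -exprVn -Da -(powR_mulrn k (powR_ge0 _ _)) powRAC.
    rewrite powR_mulrn ?exprn_ge0 ?(ltW D0)//.
    rewrite -exprM -powRM ?(ltW (T0 k)) ?(ltW (P0 k))//.
    by rewrite /T divfK// gt_eqF.
  rewrite !powRN => ->; rewrite invfM invrK mulfK//.
  by rewrite expf_neq0// gt_eqF.
have mo (U : set X) : open U -> measurable U by case: muC => _ + _; apply.
have up := integral_dist_weight_le a0 T0 T_le mu mo (mball x s).
apply: le_trans (up E) _.
set b := fine (mu (ball x s)).
have bE : mu (ball x s) = b%:E by rewrite fineK// (mu_ball_fin muC).
have b0 : 0 <= b by rewrite fine_ge0.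
rewrite T00 bE; set W := h `^ (- a).
have W0 : 0 <= W by rewrite powR_ge0.
have term k : ((T k.+1 `^ (- a))%:E * mu (neighborhood E (T k) `&` ball x s)
    <= (W * C ^+ 2 * b / eta * eta ^+ k)%:E)%E.
  have m3 : (mu (ball x (3 * s)) <= (C ^+ 2 * b)%:E)%E.
    apply: (@le_trans _ _ (mu (ball x (2 ^+ 2 * s)))).
      apply: le_measure; rewrite ?inE//; apply: le_ball.
      by rewrite (_ : 2 ^+ 2 = 4 :> R); [lra|ring].
    by rewrite EFinM -bE; exact: (mu_ball_pow2 muC).
  have theta0 : 0 <= theta by rewrite -eta_theta exprn_ge0// ltW.
  have mk : (mu (neighborhood E (T k) `&` ball x s)
      <= (eta ^+ 2 ^+ k * (C ^+ 2 * b))%:E)%E.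
    rewrite eta_theta EFinM.
    apply: (@le_trans _ _ ((theta ^+ k)%:E * mu (ball x (3 * s)))%E); last first.
      by apply: lee_wpmul2l => //; rewrite lee_fin exprn_ge0.
    apply: le_trans _ (neighborhood_decay x k s0).
    apply: le_measure; rewrite ?inE; [exact: measurableI..|].
    move=> z [zT xz]; split => //; apply: le_ball xz.
    by rewrite lerDl divr_ge0 ?exprn_ge0// mulr_ge0// ltW.
  apply: le_trans (lee_wpmul2l _ mk) _; first by rewrite lee_fin powR_ge0.
  rewrite -EFinM lee_fin TE le_eqVlt; apply/orP; left; apply/eqP.
  rewrite exprS -exprM mul2n -addnn exprD -/W; field.
  by rewrite expf_neq0 gt_eqF.
apply: (@le_trans _ _ ((W * b)%:E + (W * C ^+ 2 * b / eta / (1 - eta))%:E)%E).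
  rewrite EFinM leeD2l//.
  apply: le_trans _ (geometric_nneseries_le _ (ltW eta0) eta1).
    apply: lee_nneseries => [k _ _|k _]; last exact: term.
    by rewrite mule_ge0// lee_fin powR_ge0.
  by rewrite divr_ge0 ?(ltW eta0)// !mulr_ge0 ?exprn_ge0 ?(ltW C0).
rewrite -EFinD -EFinM lee_fin le_eqVlt; apply/orP; left; apply/eqP.
rewrite /bound -/W; field.
by rewrite !gt_eqF//= subr_gt0.
Qed.

Lemma max_hole_quadruple x s : 0 < s ->
  max_hole E x (4 * s) <= D ^+ 2 * max_hole E x s.
Proof.
move=> s0; have := max_hole_div_pow2 x 2 (_ : 0 < 4 * s).
rewrite (_ : 4 * s / 2 ^+ 2 = s); last by field.
by apply; rewrite mulr_gt0.
Qed.

Lemma porous_muckenhoupt : muckenhoupt_A1 mu (dist_weight E a).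
Proof.
have mw : measurable_fun [set: X] (dist_weight E a).
  by apply: measurable_dist_weight => //; case: muC.
have bound0 : 0 <= bound.
  by rewrite addr_ge0// divr_ge0 ?exprn_ge0 ?(ltW C0)// mulr_ge0 ?subr_ge0 ?ltW.
split.
  split => // [z|x]; first exact: dist_weight_ge0.
  exists 1 => //; apply/integrableP; split; first exact: measurable_funTS.
  under eq_integral do rewrite gee0_abs ?dist_weight_ge0//.
  apply: le_lt_trans (porous_integral_le x ltr01) _.
  by rewrite ltey_eq fin_numM// (mu_ball_fin muC).
(* The first constant serves balls far from [E], the second those close to it. *)
pose K := Num.max (3 `^ a) (bound * (D ^+ 2) `^ a).
have K3 : 3 `^ a <= K by rewrite le_max lexx.
have KD : bound * (D ^+ 2) `^ a <= K by rewrite le_max lexx orbT.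
have K0 : 0 <= K by apply: le_trans K3; exact: powR_ge0.
exists K => // x s s0.
have mpos := mu_ball_gt0 muC x s0; have mfin := mu_ball_fin muC x s.
suff avg : (\int[mu]_(z in ball x s) dist_weight E a z
    <= K%:E * ess_inf_on mu (ball x s) (dist_weight E a) * mu (ball x s))%E.
  move: mpos mfin avg; case: (mu _) => // b; rewrite lte_fin => b0 _ avg.
  by rewrite inver gt_eqF// lee_pdivrMl// muleC.
have ess_inf_ge (v : \bar R) : (forall z, ball x s z -> v <= dist_weight E a z)%E ->
    (v <= ess_inf_on mu (ball x s) (dist_weight E a))%E.
  by move=> vw; apply: ereal_sup_ubound; apply/aeW.
have [near|far] := pselect (neighborhood E (2 * s) x).
  set h := max_hole E x s; have h0 : 0 < h by exact: porous_max_hole_gt0.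
  have D2h : 0 < D ^+ 2 * h by rewrite mulr_gt0// exprn_gt0.
  apply: le_trans (porous_integral_le x s0) _; apply: lee_wpmul2r => //.
  apply: le_trans (lee_wpmul2l _ (ess_inf_ge ((D ^+ 2 * h) `^ (- a))%:E _)).
  - rewrite -EFinM lee_fin -/h.
    have -> : h `^ (- a) = (D ^+ 2) `^ a * (D ^+ 2 * h) `^ (- a).
      rewrite !powRN powRM ?exprn_ge0 ?(ltW D0) ?(ltW h0)// invfM mulrA divff ?mul1r//.
      by rewrite gt_eqF// powR_gt0// exprn_gt0.
    by rewrite mulrA ler_wpM2r// powR_ge0.
  - by rewrite lee_fin.
  move=> z; rewrite in_ballE => xz.
  rewrite -poweR_inv_powRN//; apply: le_dist_weight => //; first by rewrite lee_fin ltW.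
  apply/lee_addgt0Pr => e e0; rewrite leNgt; apply/negP => zfar.
  have zE : ~ neighborhood E (D ^+ 2 * h + e) z.
    by move/set_dist_ltP; rewrite EFinD ltNge (ltW zfar).
  (* A ball of radius at most [3 * s] at [z] fits into [ball x (4 * s)], so a [t]-ball missing [E]
     obeys [t <= D ^+ 2 * h]. Hence the minimum is [3 * s], yet [z] is within [3 * s] of [E]. *)
  pose t := Num.min (D ^+ 2 * h + e) (3 * s).
  have t0 : 0 < t by rewrite /t lt_min addr_gt0//= mulr_gt0.
  have ts : t <= 3 * s by rewrite /t ge_min lexx orbT.
  have th : t <= D ^+ 2 * h.
    apply: le_trans _ (max_hole_quadruple x s0).
    apply: (@far_le_max_hole _ _ _ _ _ z); [by []|lra|].
    move=> /(le_neighborhood (t := D ^+ 2 * h + e)) tE; apply: zE; apply: tE.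
    by rewrite /t ge_min lexx.
  have sh : 3 * s <= D ^+ 2 * h by move: th; rewrite /t ge_min => /orP[|//]; lra.
  apply: zE; apply: le_neighborhood (_ : neighborhood E (3 * s) z); first by lra.
  by apply: (neighborhood_near near); rewrite metric_sym; lra.
(* Here dist(x, E) is at least [2 * s], so dist(y, E) is at least [s], and dist(z, E), at most
   [2 * s] larger, is at most three times dist(y, E). *)
have w3 y z : ball x s y -> ball x s z ->
    (dist_weight E a y <= (3 `^ a)%:E * dist_weight E a z)%E.
  rewrite !in_ballE => xy xz.
  have xE : ((2 * s)%:E <= set_dist x E)%E.
    by rewrite leNgt; apply/negP => /set_dist_ltP.
  have yE := le_trans xE (set_dist_triangle E x y).
  have zy : mdist z y <= 2 * s.
    by apply: le_trans (metric_triangle z x y) _; rewrite metric_sym; lra.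
  have zE := set_dist_triangle E z y.
  move: yE zE; case e : (set_dist y E) => [r| |] yE zE.
  - move: yE; rewrite -EFinD lee_fin => yE.
    have r0 : 0 < r by lra.
    have zr : (set_dist z E <= (3 * r)%:E)%E.
      by apply: le_trans zE _; rewrite -EFinD lee_fin; lra.
    have yw : (dist_weight E a y <= (r `^ (- a))%:E)%E.
      rewrite -poweR_inv_powRN//; apply: dist_weight_le => //; last by rewrite e.
      by rewrite lee_fin ltW.
    have zw : (((3 * r) `^ (- a))%:E <= dist_weight E a z)%E.
      rewrite -poweR_inv_powRN ?mulr_gt0//; apply: le_dist_weight => //.
      by rewrite lee_fin mulr_ge0// ltW.
    apply: le_trans yw _; apply: le_trans (lee_wpmul2l _ zw); last first.
      by rewrite lee_fin powR_ge0.
    rewrite -EFinM lee_fin !powRN powRM ?(ltW r0)// invfM mulrA divff ?mul1r//.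
  (* Infinite distance, as for empty [E]: the weight is 0 at [y]. *)
  - rewrite {1}/dist_weight e poweRyr ?gt_eqF// invey.
    by rewrite mule_ge0 ?dist_weight_ge0// lee_fin powR_ge0.
  - by have := set_dist_ge0 E y; rewrite e.
set I := ess_inf_on _ _ _.
have I0 : (0 <= I)%E by apply: ess_inf_ge => z _; exact: dist_weight_ge0.
have p3 : 0 < 3 `^ a :> R by rewrite powR_gt0.
rewrite -integral_cst//; apply: ge0_le_integral => //.
- by move=> z _; exact: dist_weight_ge0.
- exact: measurable_funTS.
move=> y xy /=; apply: (@le_trans _ _ ((3 `^ a)%:E * I)%E); last first.
  by apply: lee_wpmul2r => //; rewrite lee_fin.
rewrite -lee_pdivrMl//; apply: ess_inf_ge => z xz.
by rewrite lee_pdivrMl//; exact: w3.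
Qed.

End porous_decay.

(** * Choice of the exponent, and the equivalence *)

Lemma powR_surj {R : realType} (x y : R) : 1 < x -> 1 < y ->
  exists2 a, 0 < a & x `^ a = y.
Proof.
move=> x1 y1; have lx : 0 < ln x by rewrite ln_gt0.
exists (ln y / ln x); first by rewrite divr_gt0// ln_gt0.
rewrite /powR gt_eqF; last by apply: lt_trans x1.
by rewrite divfK ?gt_eqF// lnK// posrE; apply: lt_trans y1.
Qed.

Theorem theorem1p1 (d : measure_display) (R : realType)
    (X : completeMetricMeasurableType d R) (mu : {measure set X -> \bar R})
    (mu_complete : measure_is_complete mu)
    (mu_borel_regular : borel_regular mu)
    (mu_doubling : doubling_measure mu)
    (E : set X) :
  (weakly_porous mu E /\ max_hole_doubling E) <->
  (exists2 a : R, 0 < a & muckenhoupt_A1 mu (dist_weight E a)).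
Proof.
have [C muC] := doubling_measureP mu_borel_regular mu_doubling.
split=> [[[c [delta [/andP[c0 _] /andP[delta0 delta1] porous]]] [D' _ dbl]]|].
  have [C1 _ _] := muC; have C3 : 0 < C ^+ 3 by rewrite exprn_gt0; lra.
  pose D := Num.max 2 D'; have D2 : 2 <= D by rewrite le_max lexx.
  have dblD x s : 0 < s -> max_hole E x (2 * s) <= D * max_hole E x s.
    move=> /dbl H; apply: le_trans (H x) _.
    by rewrite ler_wpM2r ?max_hole_ge0// le_max lexx orbT.
  clearbody D; have D1 : 1 < D by lra.
  pose m := (Num.truncn (4 * D ^+ 2 / delta)).+1.
  have Dm : 4 * D ^+ 2 <= delta * D ^+ m.
    rewrite [leRHS]mulrC -ler_pdivrMr//; apply: le_trans (ltW (truncnS_gt _)) _.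
    rewrite -/m; apply: (@le_trans _ _ (2 ^+ m)).
      by rewrite -natrX ler_nat ltnW// ltn_expl.
    by rewrite lerXn2r ?nnegrE//; lra.
  pose theta := C ^+ 3 / (c + C ^+ 3).
  have theta0 : 0 < theta by rewrite divr_gt0// addr_gt0.
  have theta1 : theta < 1 by rewrite ltr_pdivrMr ?addr_gt0// mul1r ltrDr.
  (* One factor [eta] of [theta] offsets the growth of the weight between generations, which fixes
     [a]; the other makes the series converge. *)
  pose eta := Num.sqrt theta.
  have eta0 : 0 < eta by rewrite sqrtr_gt0.
  have eta1 : eta < 1 by rewrite -sqrtr1 ltr_sqrt.
  have eta2 : eta ^+ 2 = theta by rewrite sqr_sqrtr// ltW.
  have [a a0 Da] : exists2 a, 0 < a & (D ^+ m) `^ a = eta^-1.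
    by apply: powR_surj; [rewrite exprn_egt1|rewrite invf_gt1].
  exists a => //.
  exact: (porous_muckenhoupt muC c0 delta0 porous D2 dblD _ (ltW delta1) Dm
    eta0 eta1 a0 eta2 Da).
move=> [a a0 [ww [K K0 wA1]]]; split.
  exact: (A1_weakly_porous muC a0 K0 ww wA1).
exact: (A1_max_hole_doubling muC a0 K0 ww wA1).
Qed.
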